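(* Let $n$ and $k$ be integers with $2\le k\le n-2$, and let $\Re(n,k)$ be the set of connected graphs of order $n$ with exactly $k$ pendant vertices. If $G\in\Re(n,k)$ satisfies $\rho_L(G)=\max\{\rho_L(G'):G'\in\Re(n,k)\}$, then $G\in\mathfrak{D}(n,k)$, i.e. $G\cong T(n,k;t_1,t_2)$ for some integers $t_1\ge1$, $t_2\ge1$ with $t_1+t_2=k$.
   Context: All graphs are simple and finite. For a connected graph $G$ with vertex set $\{v_1,\dots,v_n\}$, $d_G(u,v)$ is the distance between $u$ and $v$, and the transmission of $u$ is $Tr_G(u)=\sum_{v\in V(G)}d_G(u,v)$. Let $Tr(G)$ be the diagonal matrix with $(i,i)$-entry $Tr_G(v_i)$ and $D(G)=(d_G(v_i,v_j))$ the distance matrix. The distance Laplacian matrix is $L_D(G)=Tr(G)-D(G)$ and $\rho_L(G)$ denotes its largest eigenvalue. A pendant vertex is a vertex of degree $1$. For integers $t_1,t_2\ge1$ with $t_1+t_2=k$ and $\ell=n-k\ge2$, $T(n,k;t_1,t_2)$ denotes the tree obtained from a path $P_\ell$ of order $\ell$ by attaching $t_1$ pendant vertices (each joined by an edge) to one end vertex of the path and $t_2$ pendant vertices to the other end vertex. $\mathfrak{D}(n,k)=\{T(n,k;t_1,t_2): t_1\ge1,\ t_2\ge1,\ t_1+t_2=k\}$. *)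

(* Defs.v *)
From mathcomp Require Import all_boot all_order all_algebra.
From mathcomp Require Import boolp classical_sets reals.

Set Implicit Arguments.
Unset Strict Implicit.
Unset Printing Implicit Defensive.

Import Order.TTheory GRing.Theory Num.Theory.

Local Open Scope ring_scope.

Record sgraph (V : finType) := SGraph {
  adj : rel V;
  adj_sym : symmetric adj;
  adj_irr : irreflexive adj
}.

Definition graph_iso (V W : finType) (G : sgraph V) (H : sgraph W) : Prop :=
  exists2 f : V -> W, bijective f & forall u v, adj H (f u) (f v) = adj G u v.

Section Graphs.
Variables (V : finType) (G : sgraph V).

Definition connected_graph : Prop := forall u v : V, connect (adj G) u v.

Definition degree (u : V) : nat := #|[set v | adj G u v]|.

Definition pendants : {set V} := [set u | degree u == 1%N].

Definition walk (m : nat) (u v : V) : bool :=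
  [exists p : m.-tuple V, path (adj G) u p && (last u p == v)].

(* Length of a shortest walk. A shortest walk repeats no vertex, so lengths
   below #|V| suffice; the value is #|V| if u and v are not connected. *)
Definition dist (u v : V) : nat :=
  find (fun m => walk m u v) (iota 0 #|V|).

Lemma dist_min (u v : V) (m : nat) : walk m u v -> (dist u v <= m)%N.
Proof.
move=> wm; rewrite leqNgt; apply/negP => lt_m.
have ltV : (m < #|V|)%N.
  by apply: leq_trans lt_m _; rewrite -[leqRHS](size_iota 0) find_size.
by have := before_find 0%N lt_m; rewrite nth_iota //= add0n wm.
Qed.

Lemma dist_walk (u v : V) : connect (adj G) u v -> walk (dist u v) u v.
Proof.
move=> /connectP[p0 /shortenP[p pathp uniqp _] ->] {p0 v}.
have hasw : has (fun m => walk m u (last u p)) (iota 0 #|V|).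
  apply/hasP; exists (size p).
    by rewrite mem_iota add0n -[(size p).+1]/(size (u :: p)) -(card_uniqP uniqp)
      max_card.
  by apply/existsP; exists (in_tuple p); rewrite pathp eqxx.
have := nth_find 0%N hasw; rewrite nth_iota ?add0n //.
by have := hasw; rewrite has_find size_iota.
Qed.

Definition transmission (u : V) : nat := (\sum_(v : V) dist u v)%N.

End Graphs.

Section DistanceLaplacian.
Variables (R : realType) (n : nat) (G : sgraph 'I_n).

Definition Tr_mx : 'M[R]_n := diag_mx (\row_i (transmission G i)%:R).

Definition dist_mx : 'M[R]_n := \matrix_(i, j) (dist G i j)%:R.

Definition distL_mx : 'M[R]_n := Tr_mx - dist_mx.

(* The supremum is a maximum as soon as 0 < n: see rhoL_largest. *)
Definition rhoL : R := sup [set x : R | eigenvalue distL_mx x]%classic.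

Lemma eigenvalue_distL0 : (0 < n)%N -> eigenvalue distL_mx 0.
Proof.
move=> n_gt0.
have det0 : \det distL_mx = 0.
  apply/eqP; rewrite -det_tr; apply/det0P; exists (const_mx 1).
    apply/eqP => /matrixP/(_ 0 (Ordinal n_gt0)); rewrite !mxE.
    by apply/eqP; rewrite oner_eq0.
  apply/matrixP => i j; rewrite !mxE.
  under eq_bigr => k _ do rewrite !mxE mul1r.
  rewrite sumrB (bigD1 j) //= eqxx mulr1n big1 ?addr0; last first.
    by move=> k kj; rewrite eq_sym (negbTE kj) mulr0n.
  by rewrite /transmission natr_sum subrr.
move/eqP/det0P: det0 => [v v0 vL]; apply/eigenvalueP; exists v => //.
by rewrite vL scale0r.
Qed.

Lemma rhoL_largest : (0 < n)%N ->
  eigenvalue distL_mx rhoL /\ forall x, eigenvalue distL_mx x -> x <= rhoL.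
Proof.
move=> n_gt0.
suff [r er rmax] : exists2 r, eigenvalue distL_mx r &
    forall x, eigenvalue distL_mx x -> x <= r.
  suff -> : rhoL = r by [].
  apply/eqP; rewrite eq_le; apply/andP; split.
    by apply: ge_sup => [|x /rmax //]; exists r.
  by apply: ub_le_sup => //; exists r => x /rmax.
apply: contrapT => nomax.
pose p := char_poly distL_mx.
have chain m : exists r s, [/\ size s = m, uniq (r :: s), all (root p) (r :: s)
    & all (fun x => x <= r) s].
  elim: m => [|m [r [s [sz us rs les]]]].
    exists 0, [::]; split=> //=.
    by rewrite andbT -eigenvalue_root_char eigenvalue_distL0.
  have [r' er' ltr'] : exists2 r', eigenvalue distL_mx r' & r < r'.
    apply: contrapT => none; apply: nomax; exists r.
      by rewrite eigenvalue_root_char; case/andP: rs.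
    move=> x ex; rewrite leNgt; apply/negP => lt_rx; apply: none; by exists x.
  have lt_s : all (fun x => x < r') (r :: s).
    by rewrite /= ltr'; apply: sub_all les => x /le_lt_trans; apply.
  exists r', (r :: s); split.
  - by rewrite /= sz.
  - rewrite [uniq _]/= -/(uniq (r :: s)) us andbT.
    by apply/negP => /(allP lt_s); rewrite ltxx.
  - by rewrite [all _ _]/= -/(all (root p) (r :: s)) rs -eigenvalue_root_char er'.
  - by apply: sub_all lt_s => x /ltW.
have [r [s [sz us rs _]]] := chain (size p).
have p0 : p != 0 by rewrite monic_neq0 // char_poly_monic.
by have := max_poly_roots p0 rs us; rewrite /= sz ltnNge leqnSn.
Qed.

End DistanceLaplacian.

(* The class of connected graphs of order n with exactly k pendant vertices,
   with vertex set 'I_n. *)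
Definition Re_class (n k : nat) (G : sgraph 'I_n) : Prop :=
  connected_graph G /\ #|pendants G| = k.

(* 'I_l is the path; the 'I_t1 vertices hang from its vertex 0 and the 'I_t2
   vertices from its vertex l - 1. *)
Definition T_adj (l t1 t2 : nat) : rel ('I_l + ('I_t1 + 'I_t2))%type :=
  fun x y => match x, y with
  | inl i, inl j => (i.+1 == j :> nat) || (j.+1 == i :> nat)
  | inl i, inr (inl _) | inr (inl _), inl i => i == 0%N :> nat
  | inl i, inr (inr _) | inr (inr _), inl i => i.+1 == l
  | inr _, inr _ => false
  end.

Lemma T_adj_sym l t1 t2 : symmetric (@T_adj l t1 t2).
Proof. by move=> [i|[i|i]] [j|[j|j]] //=; rewrite orbC. Qed.

Lemma T_adj_irr l t1 t2 : irreflexive (@T_adj l t1 t2).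
Proof. by move=> [i|[i|i]] //=; rewrite gtn_eqF. Qed.

Definition T_graph (n k t1 t2 : nat) : sgraph ('I_(n - k) + ('I_t1 + 'I_t2))%type :=
  SGraph (@T_adj_sym (n - k) t1 t2) (@T_adj_irr (n - k) t1 t2).

Definition D_class (n k : nat) (G : sgraph 'I_n) : Prop :=
  exists t1 t2 : nat, [/\ (1 <= t1)%N, (1 <= t2)%N, (t1 + t2)%N = k
    & graph_iso G (T_graph n k t1 t2)].

(* Main.v *)
(* The largest eigenvalue rho of the distance Laplacian is the maximum of
   sum_u sum_v d(u,v) (x_u - x_v)^2 / (2 |x|^2), so it can only grow when edges are
   deleted. Let G be acyclic and let w have three distinct neighbours b, a1, a2.
   If the branch at b is reattached at a vertex w' instead of w, then its distances
   to the other vertices are convex functions of w' along the path a1, w, a2; hence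
   moving it to a1 or moving it to a2 increases rho, strictly for one of the two.
   The move costs no pendant vertex if a1 and a2 are not pendant, and at most one
   in general.

   Now maximize rho over all connected graphs with at least k pendant vertices.
   An acyclic maximizer has exactly k of them, and a vertex with two non-pendant
   neighbours has no other neighbour, so the non-pendant vertices form a path
   whose two ends carry all pendant vertices. A maximizer with exactly k pendant
   vertices cannot have a cycle: it would have a connected spanning subgraph with
   more pendant vertices, which would again be a maximizer. *)

Require Import Defs.
From mathcomp Require Import all_boot all_order all_algebra.
From mathcomp Require Import zify ring lra.
From mathcomp Require Import boolp classical_sets reals topology normedtype derive.

Set Implicit Arguments.
Unset Strict Implicit.
Unset Printing Implicit Defensive.

Import Order.TTheory GRing.Theory Num.Theory.

(** * Distances and branches *)

Section Distance.
Variables (V : finType) (G : sgraph V).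
Implicit Types (u v w : V) (m : nat).

Lemma walkP m u v :
  reflect (exists p, [/\ size p = m, path (adj G) u p & last u p = v])
    (walk G m u v).
Proof.
apply: (iffP existsP) => [[p /andP[pathp /eqP <-]]|[p [<- pathp <-]]].
  by exists p; rewrite size_tuple.
by exists (in_tuple p); rewrite pathp eqxx.
Qed.

Lemma adj_connect_sym : connect_sym (adj G).
Proof. exact/sym_connect_sym/adj_sym. Qed.

(** Along a shortest walk [g] rises by at most one per edge. This is the tool for lower bounds on
    distances. *)
Lemma dist_lipschitz (g : V -> nat) u v :
  (forall x y, adj G x y -> (g y <= (g x).+1)%N) -> g u = 0%N ->
  connect (adj G) u v -> (g v <= dist G u v)%N.
Proof.
move=> lip gu0 /dist_walk/walkP[p [<- pathp <-]].
rewrite -[leqRHS]add0n -gu0; elim: p u {gu0} pathp => [|x p IHp] u /=.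
  by rewrite addn0.
by case/andP=> ux /IHp; have := lip _ _ ux; lia.
Qed.

Lemma dist_xx u : dist G u u = 0%N.
Proof. by apply/eqP; rewrite -leqn0; apply/dist_min/walkP; exists [::]. Qed.

Hypothesis connG : connected_graph G.

Lemma dist_eq0 u v : (dist G u v == 0%N) = (u == v).
Proof.
apply/eqP/eqP => [d0|->]; last exact: dist_xx.
have /walkP[p [/size0nil -> _ <-]] : walk G 0 u v by rewrite -d0; apply: dist_walk.
by [].

Qed.

Lemma dist_rcons u v w : adj G v w -> (dist G u w <= (dist G u v).+1)%N.
Proof.
move=> vw; have /walkP[p [<- pathp lastp]] := dist_walk (connG u v).
apply/dist_min/walkP; exists (rcons p w).
by rewrite size_rcons rcons_path last_rcons pathp lastp vw.
Qed.

Lemma dist_cons u v w : adj G u v -> (dist G u w <= (dist G v w).+1)%N.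
Proof.
move=> uv; have /walkP[p [<- pathp lastp]] := dist_walk (connG v w).
by apply/dist_min/walkP; exists (v :: p); rewrite /= uv.
Qed.

Lemma dist_sym u v : dist G u v = dist G v u.
Proof.
suff le_d x y : (dist G x y <= dist G y x)%N.
  by apply/eqP; rewrite eqn_leq !le_d.
apply: (dist_lipschitz (g := dist G ^~ y)) => [z t zt||]; last exact: connG.
  by apply: dist_cons; rewrite adj_sym.
exact: dist_xx.
Qed.

Lemma dist_triangle u v w : (dist G u w <= dist G u v + dist G v w)%N.
Proof.
rewrite -leq_subLR.
apply: (dist_lipschitz (g := fun z => dist G u z - dist G u v)%N).
- by move=> x y xy; have := dist_rcons u xy; lia.
- exact: subnn.
- exact: connG.
Qed.

Lemma dist_adj u v : adj G u v -> dist G u v = 1%N.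
Proof.
move=> uv; apply/eqP; rewrite eqn_leq; apply/andP; split.
  by have := dist_rcons u uv; rewrite dist_xx.
by rewrite lt0n dist_eq0; apply: contraTneq uv => ->; rewrite adj_irr.
Qed.

End Distance.

(** * Branches at a vertex of an acyclic graph *)

Section Branches.
Variables (V : finType) (G : sgraph V).
Implicit Types (u v w a b c : V).

(** Deletes [w] without changing the vertex type: [w] stays as an isolated vertex. *)
Definition off w := [rel x y | [&& adj G x y, x != w & y != w]].

Definition branch w b := [set v | connect (off w) b v].

(** A cycle through [w] amounts to two distinct neighbours of [w] joined by a walk avoiding [w]. *)
Definition acyclic := forall w a b,
  adj G w a -> adj G w b -> connect (off w) a b -> a = b.

Lemma off_connect_sym w : connect_sym (off w).
Proof.
by apply: sym_connect_sym => x y /=; rewrite adj_sym [(x != w) && _]andbC.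
Qed.

Lemma connect_off_neq w a b : connect (off w) a b -> a != w -> b != w.
Proof.
move=> /connectP[p pathp ->] {b}; elim: p a pathp => //= x p IHp a.
by case/andP=> /and3P[_ _ xw] /IHp /(_ xw).
Qed.

Lemma adj_neq u v : adj G u v -> u != v.
Proof. by apply: contraTneq => ->; rewrite adj_irr. Qed.

Lemma branch_refl w b : b \in branch w b.
Proof. by rewrite inE connect0. Qed.

Lemma branchN w b : adj G w b -> w \notin branch w b.
Proof.
move=> wb; rewrite inE; apply/negP => /connect_off_neq.
by rewrite eq_sym (adj_neq wb) eqxx => /(_ isT).
Qed.

Lemma branch_adj w b x y : adj G w b -> x \in branch w b -> adj G x y ->
  y != w -> y \in branch w b.
Proof.
move=> wb; rewrite !inE => bx xy yw; apply: (connect_trans bx (connect1 _)).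
rewrite /= xy yw andbT; apply: contraTneq xy => xw; rewrite xw in bx.
by have := connect_off_neq bx; rewrite eq_sym (adj_neq wb) eqxx => /(_ isT).
Qed.

Hypothesis acycG : acyclic.

(** A branch is closed under adjacency away from [w], so [y] is [w]; then [x] and [b] are neighbours
    of [w] connected off [w], hence equal. *)
Lemma branch_cross w b x y : adj G w b -> adj G x y -> x \in branch w b ->
  y \notin branch w b -> x = b /\ y = w.
Proof.
move=> wb xy xB; have [yw _|yw] := eqVneq y w; last first.
  by rewrite (branch_adj wb xB xy yw).
split=> //; apply/esym/(acycG wb); last by rewrite inE in xB.
by rewrite -yw adj_sym.
Qed.

Lemma branch_disjoint w a b v : adj G w a -> adj G w b -> a != b ->
  v \in branch w a -> v \notin branch w b.
Proof.
move=> wa wb + va; apply: contraNN => vb; apply/eqP/(acycG wa wb).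
rewrite !inE in va vb; apply: connect_trans va _.
by rewrite off_connect_sym.
Qed.

End Branches.

(** * Distances after rehanging a branch *)

Section BranchDistance.
Variables (V : finType) (G : sgraph V).

(* The distance between [u] and [v] once [B] hangs from [c] by the edge [b c]. *)
Definition hung_dist (B : {set V}) b c u v : nat :=
  if (u \in B) == (v \in B) then dist G u v
  else if u \in B then (dist G u b + (dist G c v).+1)%N
  else (dist G u c + (dist G b v).+1)%N.

Hypothesis connG : connected_graph G.

Lemma hung_dist_sym B b c u v : hung_dist B b c u v = hung_dist B b c v u.
Proof.
rewrite /hung_dist eq_sym; case: ifP => [_|]; first exact: dist_sym.
have := dist_sym connG u b; have := dist_sym connG u c.
have := dist_sym connG v b; have := dist_sym connG v c.
by case: (u \in B); case: (v \in B) => //=; lia.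
Qed.

(** With [u] fixed, [hung_dist] rises by at most one along each edge of [G']: edges within a side
    are edges of [G], and across [b c], the only possible crossing edge, it changes by exactly
    one. *)
Lemma hung_dist_le (G' : sgraph V) (B : {set V}) b c u v :
    connected_graph G' -> b \in B -> c \notin B ->
    (forall x y, adj G' x y -> (x \in B) = (y \in B) -> adj G x y) ->
    (forall x y, adj G' x y -> x \in B -> y \notin B -> x = b /\ y = c) ->
  (hung_dist B b c u v <= dist G' u v)%N.
Proof.
move=> connG' bB cB inner cross.
apply: (dist_lipschitz (g := hung_dist B b c u)); last exact: connG'.
  move=> x y xy; rewrite /hung_dist.
  have [xyB|] := eqVneq (x \in B) (y \in B).
    have xyG := inner _ _ xy xyB; rewrite -xyB.
    by case: ifP => _; [|case: ifP => _];
      have := dist_rcons connG u xyG; have := dist_rcons connG c xyG;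
      have := dist_rcons connG b xyG; lia.
  case: (boolP (x \in B)) => xB; case: (boolP (y \in B)) => yB // _.
    have [-> ->] := cross _ _ xy xB yB.
    by case: (u \in B) => /=; rewrite !dist_xx; lia.
  rewrite adj_sym in xy; have [-> ->] := cross _ _ xy yB xB.
  by case: (u \in B) => /=; rewrite !dist_xx; lia.
by rewrite /hung_dist eqxx dist_xx.
Qed.

Hypothesis acycG : acyclic G.

(** Hanging the branch from [w] itself gives back [G]: [hung_dist_le] with [G' = G] yields one
    inequality, the triangle inequality through [b] and [w] the other. *)
Lemma branch_dist w b u v : adj G w b ->
  hung_dist (branch G w b) b w u v = dist G u v.
Proof.
move=> wb; have bB := branch_refl G w b; have wB := branchN wb.
apply/eqP; rewrite eqn_leq; apply/andP; split.
  by apply: hung_dist_le => // x y xy; apply: (branch_cross acycG).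
rewrite /hung_dist; case: ifP => // _.
have d1 : dist G w b = 1%N by apply: dist_adj.
have d2 : dist G b w = 1%N by rewrite dist_sym.
by case: ifP => _; [have := dist_triangle connG u b v;
    have := dist_triangle connG b w v
  | have := dist_triangle connG u w v; have := dist_triangle connG w b v]; lia.
Qed.

Lemma dist_nbr w a c : adj G w a ->
  if c \in branch G w a then dist G w c = (dist G a c).+1
  else dist G a c = (dist G w c).+1.
Proof.
move=> wa; have aB := branch_refl G w a; have wB := branchN wa.
have := branch_dist w c wa; have := branch_dist a c wa.
rewrite /hung_dist aB (negbTE wB) !dist_xx.
by case: (c \in _) => //= ->.
Qed.

Lemma dist_nbr_neq w a c : adj G w a -> dist G w c != dist G a c.
Proof. by move=> wa; have := dist_nbr c wa; case: ifP => _; lia. Qed.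

(** [c] lies in at most one of the disjoint branches at [a] and [b]. A step from [w] into a branch
    without [c] adds one to the distance, which makes up for a possible loss of one on the other
    side. *)
Lemma dist_convex w a b c : adj G w a -> adj G w b -> a != b ->
  (2 * dist G w c <= dist G a c + dist G b c)%N.
Proof.
move=> wa wb ab; have := dist_nbr c wa; have := dist_nbr c wb.
case: ifP => cb; case: ifP => ca; try lia.
by have := branch_disjoint acycG wa wb ab ca; rewrite cb.
Qed.

End BranchDistance.

(** * Exchanging an edge *)

Section Swap.
Variables (V : finType) (G : sgraph V).
Implicit Types (s a b c w : V).

Definition same_edge (x y u v : V) :=
  (u == x) && (v == y) || (u == y) && (v == x).

(** The guard [u != v] keeps the relation irreflexive when [s = c]. *)
Definition swap_adj s a c : rel V := fun u v =>
  (u != v) && (adj G u v && ~~ same_edge s a u v || same_edge s c u v).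

Lemma same_edgeC x y u v : same_edge x y u v = same_edge x y v u.
Proof. by rewrite /same_edge orbC ![(u == _) && _]andbC. Qed.

Lemma swap_sym s a c : symmetric (swap_adj s a c).
Proof.
by move=> u v; rewrite /swap_adj eq_sym adj_sym !(same_edgeC _ _ u).
Qed.

Lemma swap_irr s a c : irreflexive (swap_adj s a c).
Proof. by move=> u; rewrite /swap_adj eqxx. Qed.

(* The edge [s a] is replaced by [s c]; if [s c] is an edge already, then
   [s a] is just deleted. *)
Definition swap s a c := SGraph (@swap_sym s a c) (@swap_irr s a c).

(** [s] still reaches [a] through [c]: the walk from [c] to [a] avoids [s], so none of its edges is
    touched. *)
Lemma swap_connected s a c : connected_graph G -> s != c ->
  connect (off G s) c a -> connected_graph (swap s a c).
Proof.
move=> connG sc ca u v; have := connG u v; apply: connect_sub => x y xy.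
have offE p q : connect (off G s) p q -> connect (adj (swap s a c)) p q.
  apply: connect_sub => z t /= /and3P[zt zs ts]; apply: connect1.
  by rewrite /= /swap_adj zt (adj_neq zt) /same_edge !(negbTE zs) !(negbTE ts) andbF.
have sa : connect (adj (swap s a c)) s a.
  apply: connect_trans (offE _ _ ca); apply: connect1.
  by rewrite /= /swap_adj sc /same_edge !eqxx orbT.
have [/orP[]/andP[/eqP-> /eqP->]|xyE] := boolP (same_edge s a x y).
- by [].
- by rewrite adj_connect_sym.
- by apply: connect1; rewrite /= /swap_adj xy xyE (adj_neq xy).
Qed.

Hypotheses (connG : connected_graph G) (acycG : acyclic G).

(** By [branch_cross], [b w] is the only edge of [G] leaving the branch, so after the exchange [b a]
    is the only one and [hung_dist_le] applies. *)
Lemma move_dist w b a u v : adj G w b -> adj G w a -> a != b ->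
  (hung_dist G (branch G w b) b a u v <= dist (swap b w a) u v)%N.
Proof.
move=> wb wa ab; set B := branch G w b.
have aB : a \notin B.
  by apply: (branch_disjoint acycG wa wb ab); apply: branch_refl.
have bB : b \in B := branch_refl _ _ _.
have wB : w \notin B := branchN wb.
apply: (hung_dist_le connG) => //.
- apply: swap_connected => //; first by rewrite eq_sym.
  by apply: connect1; rewrite /= ab (adj_neq wb) adj_sym wa.
- move=> x y /andP[_ /orP[/andP[]//|]].
  by case/orP=> /andP[/eqP-> /eqP->]; rewrite bB (negbTE aB).
- move=> x y /andP[_ /orP[/andP[xy]|]] + xB yB.
    have [-> ->] := branch_cross acycG wb xy xB yB.
    by rewrite /same_edge !eqxx.
  by case/orP=> /andP[/eqP xE /eqP yE] //; rewrite xE (negbTE aB) in xB.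
Qed.

End Swap.

(** * Pendant vertices and spanning subgraphs *)

Section Pendants.
Variables (V : finType) (G : sgraph V).
Implicit Types (u v w x y z : V).

Lemma connected_step u v : connected_graph G -> u != v ->
  exists z, adj G u z.
Proof.
move=> connG; have /connectP[[|z p] /= pathp ->] := connG u v.
  by rewrite eqxx.
by case/andP: pathp => uz _; exists z.
Qed.

Lemma connected_nbr u : connected_graph G -> (1 < #|V|)%N ->
  exists z, adj G u z.
Proof.
move=> connG /card_gt1P[x [y [_ _ xy]]].
have [ux|] := eqVneq u x; first by apply: (@connected_step u y); rewrite ?ux.
exact: connected_step.
Qed.

Lemma pendantP u : connected_graph G -> (1 < #|V|)%N ->
  reflect (forall x y, adj G u x -> adj G u y -> x = y) (u \in pendants G).
Proof.
move=> connG n1; rewrite inE /degree eqn_leq.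
have -> : (0 < #|[set v | adj G u v]|)%N.
  by have [z uz] := connected_nbr u connG n1; apply/card_gt0P; exists z; rewrite inE.
rewrite andbT; apply: (iffP card_le1_eqP) => uniq_nbr x y.
  by move=> ux uy; apply: uniq_nbr; rewrite inE.
by rewrite !inE => ux uy; apply: uniq_nbr.
Qed.

Lemma pendant_uniq u x y : u \in pendants G -> adj G u x -> adj G u y -> x = y.
Proof.
rewrite inE => /eqP/eq_leq/card_le1_eqP uniq_nbr ux uy.
by apply: uniq_nbr; rewrite inE.
Qed.

Lemma nonpendant_nbr u x : connected_graph G -> (1 < #|V|)%N ->
  u \notin pendants G -> exists2 y, adj G u y & y != x.
Proof.
move=> connG n1 /(pendantP _ connG n1) npend; apply: contrapT => none.
apply: npend => y z uy uz; transitivity x; last symmetry.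
  by apply: contrapT => /eqP yx; apply: none; exists y.
by apply: contrapT => /eqP zx; apply: none; exists z.
Qed.

Lemma path_interior a p v : path (adj G) a p -> uniq (a :: p) -> v \in p ->
  v != last a p ->
  exists x y, [/\ x != y, adj G v x, adj G v y, x \in a :: p & y \in a :: p].
Proof.
move=> + + vp; case/splitPr: vp => p1 [|y p2]; first by rewrite last_cat eqxx.
move=> + uniqp _; rewrite cat_path /= => /and3P[_ xv /andP[vy _]].
exists (last a p1), y; split=> //.
- move: uniqp; rewrite -cat_cons cat_uniq => /and3P[_ /hasPn disj _].
  apply: contraTneq (disj y _) => [<-|]; first by rewrite negbK mem_last.
  by rewrite !inE eqxx orbT.
- by rewrite adj_sym.
- by rewrite -cat_cons mem_cat mem_last.
- by rewrite inE mem_cat !inE eqxx !orbT.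
Qed.

Lemma path_nonpendant a p : path (adj G) a p -> uniq (a :: p) ->
  a \notin pendants G -> last a p \notin pendants G ->
  {in a :: p, forall v, v \notin pendants G}.
Proof.
move=> pathp uniqp aN lN v; rewrite inE => /predU1P[->//|vp].
have [->//|vl] := eqVneq v (last a p).
have [x [y [xy vx vy _ _]]] := path_interior pathp uniqp vp vl.
by apply: contraNN xy => vP; rewrite (pendant_uniq vP vx vy).
Qed.

Lemma path_leave (A : {pred V}) a p : path (adj G) a p -> a \in A ->
  last a p \notin A ->
  exists x y, [/\ x \in A, y \notin A, y \in p & adj G x y].
Proof.
elim: p a => [|b p IHp] a /=; first by move=> _ ->.
case/andP=> ab pathp aA lA; have [bA|bA] := boolP (b \in A).
  have [x [y [xA yA yp xy]]] := IHp b pathp bA lA.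
  by exists x, y; rewrite inE yp orbT.
by exists a, b; rewrite mem_head.
Qed.

(** Otherwise every vertex has at most two neighbours, so a path between pendant vertices [a] and
    [b] is closed under adjacency and covers the graph; the pendant vertex [c] would be interior to
    it and have two neighbours. *)
Lemma exists_branching : connected_graph G -> (2 < #|pendants G|)%N ->
  exists w a b c, [/\ [/\ adj G w a, adj G w b & adj G w c],
    a != b, a != c & b != c].
Proof.
move=> connG /card_gt2P[a [b [c [[aP bP cP] [ab bc ca]]]]].
apply: contrapT => none.
have /connectP[p0 /shortenP[p pathp uniqp _] lastp] := connG a b.
have closedp x y : adj G x y -> x \in a :: p -> y \in a :: p.
  move=> xy xp; have [xa|xa] := eqVneq x a.
    case: p {uniqp xp} pathp lastp => [_ ba|z p /= /andP[az _] _].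
      by rewrite ba eqxx in ab.
    by rewrite xa in xy; rewrite (pendant_uniq aP xy az) !inE eqxx orbT.
  have {xp} xp : x \in p by rewrite inE (negbTE xa) in xp.
  have [xl|xl] := eqVneq x (last a p).
    case/lastP: p {uniqp xp} pathp lastp xl => [_ ba|p z].
      by rewrite ba eqxx in ab.
    rewrite rcons_path last_rcons => /andP[_ lz] bz xz.
    rewrite xz -bz in xy; rewrite -bz adj_sym in lz.
    by rewrite (pendant_uniq bP xy lz) -rcons_cons mem_rcons inE mem_last orbT.
  have [s [t [st xs xt sp tp]]] := path_interior pathp uniqp xp xl.
  have [->//|ys] := eqVneq y s; have [->//|yt] := eqVneq y t.
  by exfalso; apply: none; exists x, y, s, t.
have cp : c \in a :: p.
  by rewrite -(closed_connect (intro_closed (adj_connect_sym G) closedp) (connG a c))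
    mem_head.
have {}cp : c \in p by rewrite inE (negbTE ca) in cp.
have cl : c != last a p by rewrite -lastp eq_sym.
have [s [t [st cs ct _ _]]] := path_interior pathp uniqp cp cl.
by rewrite (pendant_uniq cP cs ct) eqxx in st.
Qed.

End Pendants.

(** * Spanning subgraphs and the effect of a move on pendant vertices *)

Section Subgraphs.
Variable V : finType.
Implicit Types (G H : sgraph V) (u v w a b : V).

Definition subgraph H G := forall u v, adj H u v -> adj G u v.

Lemma sgraph_ext G H : (forall u v, adj G u v = adj H u v) -> G = H.
Proof.
case: G H => [e es ei] [e' es' ei'] /= eqe.
have {eqe} ee' : e = e' by apply/funext => u; apply/funext => v.
by rewrite -{}ee' in es' ei' *; congr SGraph; apply: Prop_irrelevance.
Qed.

Lemma sub_connected H G : subgraph H G -> connected_graph H -> connected_graph G.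
Proof.
move=> HG connH u v; apply: connect_sub (connH u v) => x y /HG.
exact: connect1.
Qed.

Lemma dist_sub H G u v : subgraph H G -> connected_graph H ->
  (dist G u v <= dist H u v)%N.
Proof.
move=> HG connH; have connG := sub_connected HG connH.
apply: (dist_lipschitz (g := dist G u)) => [x y /HG||].
- exact: dist_rcons.
- exact: dist_xx.
- exact: connH.
Qed.

(** Connectedness of [H] leaves every vertex a neighbour, so a vertex with a single neighbour in [G]
    keeps it. *)
Lemma pendants_sub H G : subgraph H G -> connected_graph H -> (1 < #|V|)%N ->
  pendants G \subset pendants H.
Proof.
move=> HG connH n1; apply/fintype.subsetP => u uP; apply/pendantP => // x y /HG + /HG.
exact: pendant_uniq.
Qed.

Lemma exists_acyclic G : connected_graph G ->
  exists H, [/\ connected_graph H, acyclic H & subgraph H G].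
Proof.
have [m] := ubnP #|[set e | adj G e.1 e.2]|; elim: m G => // m IHm G leGm connG.
have [acycG|cycG] := pselect (acyclic G); first by exists G; split.
have [w [a [b [wa wb ab neq_ab]]]] : exists w a b,
    [/\ adj G w a, adj G w b, connect (off G w) a b & a != b].
  apply: contrapT => none; apply: cycG => w a b wa wb ab; apply: contrapT.
  by move=> /eqP neq_ab; apply: none; exists w, a, b.
(* As [w b] is an edge already, this swap only deletes [w a], an edge on a cycle. *)
have subG : subgraph (swap G w a b) G.
  move=> x y /andP[_ /orP[/andP[]//|]] /orP[]/andP[/eqP-> /eqP->] //.
  by rewrite adj_sym.
have connS : connected_graph (swap G w a b).
  by apply: swap_connected; rewrite ?(adj_neq wb) // off_connect_sym.
have [|H [connH acycH subH]] := IHm (swap G w a b) _ connS.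
  apply: leq_trans (leGm : (_ <= m)%N); apply: proper_card; apply/properP; split.
    by apply/fintype.subsetP => e; rewrite !inE => /subG.
  exists (w, a); rewrite !inE //= /swap_adj wa /same_edge !eqxx /= (negbTE neq_ab).
  by rewrite [a == w]eq_sym (negbTE (adj_neq wa)) !andbF.
by exists H; split=> // u v /subH /subG.
Qed.

(** Only [a] gains a neighbour. A pendant [b] trades [w] for [a], and [w], with its two neighbours,
    was not pendant. *)
Lemma pendants_move G w b a : connected_graph G -> (1 < #|V|)%N ->
  adj G w b -> adj G w a -> a != b ->
  pendants G :\ a \subset pendants (swap G b w a).
Proof.
move=> connG n1 wb wa ab; apply/fintype.subsetP => u /setD1P[ua uP].
have uw : u != w.
  by apply: contraNneq ab => uw; rewrite uw in uP; rewrite (pendant_uniq uP wa wb).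
have connS : connected_graph (swap G b w a).
  apply: swap_connected; rewrite // 1?eq_sym //.
  by apply: connect1; rewrite /= ab (adj_neq wb) adj_sym wa.
apply/pendantP => // x y.
rewrite /= /swap_adj /same_edge (negbTE uw) (negbTE ua) /= !orbF.
have [ub|ub] /= := eqVneq u b; last first.
  by move=> /and3P[_ + _] /and3P[_ + _]; rewrite !andbT; apply: pendant_uniq.
rewrite ub in uP *; rewrite adj_sym in wb.
have nbr z : (b != z) && (adj G b z && (z != w) || (z == a)) -> z = a.
  case/andP=> _ /orP[/andP[bz]|/eqP //].
  by rewrite (pendant_uniq uP bz wb) eqxx.
by move=> /nbr -> /nbr ->.
Qed.

End Subgraphs.

(** * Recognizing the extremal trees *)

Section Caterpillar.
Variables (V : finType) (G : sgraph V).
Hypotheses (connG : connected_graph G) (acycG : acyclic G).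
Hypothesis nonpendant2 : (1 < #|~: pendants G|)%N.
Hypothesis inner_nbr : forall w a1 a2 b, adj G w a1 -> adj G w a2 -> a1 != a2 ->
  a1 \notin pendants G -> a2 \notin pendants G -> adj G w b -> b = a1 \/ b = a2.
Implicit Types (u v x y z : V) (p : seq V).

Definition spine p :=
  [&& uniq p, all (fun v => v \notin pendants G) p & sorted (adj G) p].

Lemma longest_spine : exists2 p, spine p & forall q, spine q -> (size q <= size p)%N.
Proof.
pose has_spine m := [exists t : m.-tuple V, spine t].
have ex0 : exists m, has_spine m.
  by exists 0%N; apply/existsP; exists [tuple].
have bound m : has_spine m -> (m <= #|V|)%N.
  move=> /existsP[t /andP[ut _]]; rewrite -(size_tuple t) -(card_uniqP ut).
  exact: max_card.
case: (ex_maxnP ex0 bound) => m /existsP[t st] maxm; exists t => // q sq.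
by rewrite size_tuple; apply: maxm; apply/existsP; exists (in_tuple q).
Qed.

(** A path from a longest spine to a missed non-pendant vertex leaves the spine by an edge [z t]
    with [t] non-pendant. *)
Lemma spine_full : exists2 p, spine p & p =i ~: pendants G.
Proof.
have [p sp maxp] := longest_spine; exists p => // y; rewrite inE.
have /and3P[uniqp /allP pN sortp] := sp.
apply/idP/idP => [/pN //|yN]; apply: contraT => yp.
have [x xp] : exists x, x \in p.
  case: p {sp uniqp pN sortp yp} maxp => [|x p _]; last by exists x; rewrite mem_head.
  by move=> /(_ [:: y]); rewrite /spine /= yN => /(_ isT).
have /connectP[q0 /shortenP[q pathq uniqq _] lastq] := connG x y.
have qN : {in x :: q, forall v, v \notin pendants G}.
  by apply: path_nonpendant; rewrite -?lastq // pN.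
rewrite lastq in yp.
have [z [t [zp tp tq zt]]] := path_leave pathq xp yp.
have tN : t \notin pendants G by apply: qN; rewrite inE tq orbT.
case/splitPr: zp sp maxp uniqp pN sortp tp {yp xp} => p1 p2.
(* If [z] is an end of the spine, [t] prolongs it; if [z] is interior, its two spine neighbours
   exclude [t] by [inner_nbr]. *)
case/lastP: p1 => [|p1 a]; last case: p2 => [|b p2].
- move=> /= + maxp; rewrite /spine /= => /and3P[uniqp allp sortp] _ _ _ tp.
  have /maxp : spine [:: t, z & p2].
    by rewrite /spine /= tN allp sortp adj_sym zt tp uniqp.
  by rewrite /= ltnn.
- rewrite cats1 => sp maxp _ _ _ tp.
  have /maxp : spine (rcons (rcons (rcons p1 a) z) t).
    case/and3P: sp => uniqp allp sortp; apply/and3P; split.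
    - by rewrite rcons_uniq tp.
    - by rewrite all_rcons tN.
    - move: sortp; case: (p1) => [|c p1'] /=; first by rewrite zt !andbT.
      by rewrite [path _ _ (rcons _ t)]rcons_path last_rcons zt => ->.
  by rewrite [size (rcons _ t)]size_rcons ltnn.
rewrite cat_rcons => _ _ uniqp pN sortp tp; exfalso.
have [za zb] : adj G z a /\ adj G z b.
  by move: sortp; rewrite sorted_cat_cons adj_sym /= => /and4P[_ -> -> _].
have ab : a != b.
  move: uniqp; rewrite cat_uniq => /and3P[_ _ /andP[+ _]].
  by rewrite !inE !negb_or => /and3P[].
have pinN v : v \in [:: a; z; b] -> v \notin pendants G.
  by move=> vp; apply: pN; move: vp; rewrite mem_cat !inE => /or3P[] ->; rewrite !orbT.
have := inner_nbr za zb ab (pinN a _) (pinN b _) zt.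
rewrite !inE !eqxx !orbT => /(_ isT isT) [] tE;
  by rewrite tE mem_cat !inE eqxx !orbT in tp.
Qed.

(** A chord from position [i] to [j] would close a cycle: the spine from [i.+1] to [j] avoids the
    vertex at [i]. *)
Lemma spine_adj p x0 i j : spine p -> (i < j < size p)%N ->
  adj G (nth x0 p i) (nth x0 p j) = (j == i.+1).
Proof.
case/and3P=> uniqp _ /(sortedP x0) sortp /andP[ij jp].
have nth_neq q : (i < q < size p)%N -> nth x0 p q != nth x0 p i.
  by case/andP=> iq qp; rewrite nth_uniq ?(ltn_trans iq) // gtn_eqF.
have off_nth q : (i < q < size p)%N ->
    connect (off G (nth x0 p i)) (nth x0 p i.+1) (nth x0 p q).
  elim: q => [|q IHq] //; rewrite ltnS leq_eqVlt => /andP[/predU1P[<- _|iq qp]].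
    exact: connect0.
  have iqp : (i < q < size p)%N by rewrite iq ltnW.
  apply: connect_trans (IHq iqp) (connect1 _).
  by rewrite /= sortp // !nth_neq // qp ltnW.
have ip : (i.+1 < size p)%N := leq_ltn_trans ij jp.
apply/idP/eqP => [adj_ij|->]; last exact: sortp.
have : nth x0 p i.+1 = nth x0 p j.
  by apply: acycG adj_ij (off_nth j _); [exact: sortp|rewrite ij].
by move/eqP; rewrite nth_uniq // => /eqP.
Qed.

(** Two adjacent pendant vertices would form the whole graph. *)
Lemma pendant_nbr u v : u \in pendants G -> adj G u v -> v \notin pendants G.
Proof.
move=> uP uv; apply/negP => vP.
have /card_gt0P[x] : (0 < #|~: pendants G|)%N by lia.
rewrite finset.in_setC => /negP; apply.
have closed_uv y z : adj G y z -> y \in [set u; v] -> z \in [set u; v].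
  move=> yz; rewrite !inE => /orP[]/eqP yE; rewrite yE in yz.
    by rewrite (pendant_uniq uP yz uv) eqxx orbT.
  by rewrite adj_sym in uv; rewrite (pendant_uniq vP yz uv) eqxx.
have : x \in [set u; v].
  by rewrite -(closed_connect (intro_closed (adj_connect_sym G) closed_uv) (connG u x))
    !inE eqxx.
by case/set2P=> ->.
Qed.

Lemma caterpillar_iso n k : #|~: pendants G| = (n - k)%N -> #|pendants G| = k ->
  exists t1 t2 : nat, [/\ (1 <= t1)%N, (1 <= t2)%N, (t1 + t2)%N = k
    & graph_iso G (T_graph n k t1 t2)].
Proof.
move=> sizeN sizeP; have [p sp pE] := spine_full.
have uniqp : uniq p by case/and3P: sp.
have size_p : size p = (n - k)%N by rewrite -(card_uniqP uniqp) (eq_card pE).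
have l_gt1 : (1 < n - k)%N by rewrite -sizeN.
have [x0 _] : exists x0, x0 \in ~: pendants G by apply/card_gt0P; lia.
pose P i := nth x0 p i; pose l := (n - k)%N.
have PN i : (i < l)%N -> P i \notin pendants G.
  by move=> il; rewrite -finset.in_setC -pE mem_nth // size_p.
have P_inj i j : (i < l)%N -> (j < l)%N -> (P i == P j) = (i == j).
  by move=> il jl; rewrite nth_uniq // size_p.
have P_adj i j : (i < l)%N -> (j < l)%N ->
    adj G (P i) (P j) = (i.+1 == j) || (j.+1 == i).
  move=> il jl; have [ij|ji|<-] := ltngtP i j.
  - by rewrite (spine_adj x0 sp) ?size_p ?ij //; lia.
  - by rewrite adj_sym (spine_adj x0 sp) ?size_p ?ji //; lia.
  - by rewrite adj_irr; lia.
have P_surj v : v \notin pendants G -> exists2 i, (i < l)%N & v = P i.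
  rewrite -finset.in_setC -pE => vp; exists (index v p); last by rewrite /P nth_index.
  by rewrite /l -size_p index_mem.
have P_leaf i v : (i < l)%N -> v \in pendants G -> adj G (P i) v ->
    i = 0%N \/ i.+1 = l.
  move=> il vP iv; have [->|i0] := posnP i; first by left.
  have [|il1] := eqVneq i.+1 l; first by right.
  have [vE|vE] : v = P i.-1 \/ v = P i.+1.
    apply: (@inner_nbr (P i)); rewrite ?P_adj ?P_inj ?PN //; lia.
  - by rewrite vE (negbTE (PN _ _)) // in vP; lia.
  - by rewrite vE (negbTE (PN _ _)) // in vP; lia.
pose A i := [set v in pendants G | adj G (P i) v].
have memA i v : (v \in A i) = (v \in pendants G) && adj G (P i) v.
  by rewrite finset.in_set.
have A_adj i j v : (i < l)%N -> (j < l)%N -> v \in A i -> adj G (P j) v = (j == i).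
  move=> il jl; rewrite memA => /andP[vP iv]; apply/idP/eqP => [jv|-> //].
  apply/eqP; rewrite -P_inj //; apply/eqP.
  by apply: (pendant_uniq vP); rewrite adj_sym.
(* A spine vertex with a single spine neighbour is an end; being non-pendant, it has another
   neighbour, which must be pendant. *)
have A_gt0 i j : (i < l)%N -> (j < l)%N -> adj G (P i) (P j) ->
    (forall q, (q < l)%N -> adj G (P i) (P q) -> q = j) -> (0 < #|A i|)%N.
  move=> il jl ij uniq_j; have V_gt1 : (1 < #|V|)%N.
    by apply: leq_trans nonpendant2 (max_card _).
  have [y iy yj] := nonpendant_nbr (P j) connG V_gt1 (PN i il).
  apply/card_gt0P; exists y; rewrite memA iy andbT; apply: contraT => /P_surj[q ql yE].
  by move: yj; rewrite yE in iy *; rewrite (uniq_j q ql iy) eqxx.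
pose e := l.-1; have el : (e < l)%N by rewrite /e; lia.
have l0 : (0 < l)%N by lia.
(* The two ends differ because [l > 1], so [A 0] and [A e] are disjoint; [P_leaf] shows that they
   exhaust the pendant vertices. *)
have sizeA : (#|A 0%N| + #|A e|)%N = k.
  rewrite -sizeP -cardsUI [A 0%N :&: _](_ : _ = finset.set0) ?cards0 ?addn0; last first.
    apply/finset.setP => v; rewrite !finset.in_setI finset.in_set0; apply/negP => /andP[v0 ve].
    by move: (ve); rewrite memA (A_adj 0%N e v) //; lia.
  apply: eq_card => v; rewrite finset.in_setU !memA -andb_orr; apply: andb_idr => vP.
  have [z vz] := connected_nbr v connG (leq_trans nonpendant2 (max_card _)).
  have [i il zE] := P_surj z (pendant_nbr vP vz); rewrite zE adj_sym in vz.
  have [i0|ie] := P_leaf i v il vP vz; first by rewrite -i0 vz.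
  by have -> : e = i by [rewrite /e; lia]; rewrite vz orbT.
exists #|A 0%N|, #|A e|; split.
- by apply: (A_gt0 _ 1%N) => //; [rewrite P_adj|move=> q ql; rewrite P_adj //]; lia.
- by apply: (A_gt0 _ e.-1) => //; [|rewrite P_adj|move=> q ql; rewrite P_adj //]; lia.
- exact: sizeA.
pose g (x : 'I_(n - k) + ('I_#|A 0%N| + 'I_#|A e|)) : V := match x with
  | inl i => P i | inr (inl a) => enum_val a | inr (inr b) => enum_val b end.
have A0 (a : 'I_#|A 0%N|) : enum_val a \in A 0%N := enum_valP a.
have Ae (b : 'I_#|A e|) : enum_val b \in A e := enum_valP b.
have AP i v : v \in A i -> v \in pendants G by rewrite memA => /andP[].
have A0e v : v \in A 0%N -> v \in A e -> False.
  by move=> v0; rewrite memA (A_adj 0%N e v) //; lia.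
have PA i j v : (i < l)%N -> v \in A j -> P i <> v.
  by move=> /PN + /AP vP Pv; rewrite Pv vP.
have g_inj : injective g.
  move=> [i|[a|b]] [j|[a'|b']] //= gE.
  - by congr inl; apply/val_inj/eqP; rewrite -(P_inj i j) // gE.
  - by case: (PA i 0%N _ (ltn_ord i) (A0 a') gE).
  - by case: (PA i e _ (ltn_ord i) (Ae b') gE).
  - by case: (PA j 0%N _ (ltn_ord j) (A0 a) (esym gE)).
  - by rewrite (enum_val_inj gE).
  - by case: (@A0e (enum_val a) (A0 a)); rewrite gE.
  - by case: (PA j e _ (ltn_ord j) (Ae b) (esym gE)).
  - by case: (@A0e (enum_val a') (A0 a')); rewrite -gE.
  - by rewrite (enum_val_inj gE).
have card_T : (#|V| <= #|{: 'I_(n - k) + ('I_#|A 0%N| + 'I_#|A e|)}|)%N.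
  by rewrite !card_sum !card_ord sizeA -sizeN -sizeP addnC cardsC.
have [f gK fK] := inj_card_bij g_inj card_T.
have g_adj s t : adj G (g s) (g t) = T_adj s t.
  have leaf_adj i j v w : v \in A i -> w \in A j -> adj G v w = false.
    by move=> /AP vP /AP wP; apply: contraTF wP => /(pendant_nbr vP).
  case: s t => [i|[a|b]] [j|[a'|b']] /=.
  - exact: P_adj.
  - by rewrite (A_adj 0%N) // A0.
  - by rewrite (A_adj e) // ?Ae // /e /l; have := ltn_ord i; lia.
  - by rewrite adj_sym (A_adj 0%N) // A0.
  - exact: leaf_adj (A0 a) (A0 a').
  - exact: leaf_adj (A0 a) (Ae b').
  - by rewrite adj_sym (A_adj e) // ?Ae // /e /l; have := ltn_ord j; lia.
  - exact: leaf_adj (Ae b) (A0 a').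
  - exact: leaf_adj (Ae b) (Ae b').
exists f; first by exists g.
by move=> u v; rewrite -{2}(fK u) -{2}(fK v) g_adj.
Qed.

End Caterpillar.

Local Open Scope ring_scope.

(** * Rayleigh quotients *)

Section QuadraticForm.
Import numFieldTopology.Exports numFieldNormedType.Exports.
Variables (R : realType) (n : nat).
Implicit Types (W : 'I_n -> 'I_n -> R) (x y : 'rV[R]_n).

(** For symmetric [W] this is twice the Laplacian quadratic form, as ordered pairs are summed; hence
    the factors 2 below. *)
Definition quad W x := \sum_i \sum_j W i j * (x 0 i - x 0 j) ^+ 2.
Definition sqn x := \sum_i x 0 i ^+ 2.

Lemma sqn_ge0 x : 0 <= sqn x.
Proof. by apply: sumr_ge0 => i _; apply: sqr_ge0. Qed.

Lemma sqn_eq0 x : (sqn x == 0) = (x == 0).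
Proof.
rewrite /sqn psumr_eq0; last by move=> i _; apply: sqr_ge0.
apply/allP/eqP => [x0|-> i _]; last by rewrite mxE expr0n eqxx.
apply/rowP => i; rewrite mxE; apply/eqP.
by have := x0 i; rewrite mem_index_enum sqrf_eq0 => /(_ isT).
Qed.

Lemma sqnZ (a : R) x : sqn (a *: x) = a ^+ 2 * sqn x.
Proof. by rewrite /sqn mulr_sumr; apply: eq_bigr => i _; rewrite mxE exprMn. Qed.

Lemma quadZ (a : R) W x : quad W (a *: x) = a ^+ 2 * quad W x.
Proof.
rewrite /quad mulr_sumr; apply: eq_bigr => i _; rewrite mulr_sumr.
by apply: eq_bigr => j _; rewrite !mxE; ring.
Qed.

Lemma ler_quad W W' x : (forall i j, W i j <= W' i j) -> quad W x <= quad W' x.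
Proof.
move=> le_W; apply: ler_sum => i _; apply: ler_sum => j _.
by rewrite ler_wpM2r ?sqr_ge0.
Qed.

(** Splitting one factor [x i - x j] of the square gives two sums, equal by symmetry of [W]. *)
Lemma quadE W x : (forall i j, W i j = W j i) ->
  quad W x = 2 * \sum_i x 0 i * \sum_j W i j * (x 0 i - x 0 j).
Proof.
move=> symW.
have half : \sum_i \sum_j W i j * (x 0 i - x 0 j) * - x 0 j
    = \sum_i x 0 i * \sum_j W i j * (x 0 i - x 0 j).
  rewrite exchange_big; apply: eq_bigr => i _; rewrite mulr_sumr.
  by apply: eq_bigr => j _; rewrite symW; ring.
rewrite mulr_natl mulr2n -{2}half -big_split; apply: eq_bigr => i _.
rewrite mulr_sumr -big_split; apply: eq_bigr => j _ /=; ring.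
Qed.

Lemma quad_perturb W x i (t : R) : (forall i j, W i j = W j i) ->
  quad W (x + t *: delta_mx 0 i) = quad W x
    + 4 * t * (\sum_j W i j * (x 0 i - x 0 j)) + t ^+ 2 * quad W (delta_mx 0 i).
Proof.
move=> symW; set e := delta_mx 0 i.
(* The polar form of [quad W] at [x] and [e]; by symmetry [e k] and [- e j] contribute equally. *)
have polar : \sum_k \sum_j W k j * (x 0 k - x 0 j) * (e 0 k - e 0 j)
    = 2 * \sum_j W i j * (x 0 i - x 0 j).
  have half : \sum_k \sum_j W k j * (x 0 k - x 0 j) * e 0 k
      = \sum_j W i j * (x 0 i - x 0 j).
    rewrite (bigD1 i) //= [X in _ + X]big1 ?addr0 => [|k ki].
      by apply: eq_bigr => j _; rewrite mxE !eqxx mulr1.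
    by apply: big1 => j _; rewrite mxE (negbTE ki) andbF mulr0.
  rewrite mulr_natl mulr2n -{1}half -half [X in _ = _ + X]exchange_big.
  rewrite -big_split; apply: eq_bigr => k _; rewrite -big_split.
  by apply: eq_bigr => j _ /=; rewrite (symW j k); ring.
transitivity (quad W x + 2 * t * (\sum_k \sum_j W k j * (x 0 k - x 0 j)
    * (e 0 k - e 0 j)) + t ^+ 2 * quad W e); last by rewrite polar; ring.
rewrite /quad !mulr_sumr -!big_split; apply: eq_bigr => k _.
rewrite !mulr_sumr -!big_split; apply: eq_bigr => j _ /=.
have xtE l : (x + t *: e) 0 l = x 0 l + t * e 0 l by rewrite !mxE.
by rewrite !xtE; ring.
Qed.

Lemma sqn_perturb x i (t : R) :
  sqn (x + t *: delta_mx 0 i) = sqn x + 2 * t * x 0 i + t ^+ 2.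
Proof.
rewrite /sqn (bigD1 i) //= [X in _ = X + _ + _](bigD1 i) //=.
rewrite (eq_bigr (fun j => x 0 j ^+ 2)) => [|j ji].
  by rewrite !mxE !eqxx /= mulr1n; ring.
by rewrite !mxE (negbTE ji) andbF mulr0 addr0.
Qed.

Lemma linear_coef_eq0 (a b : R) : (forall t, a * t + b * t ^+ 2 <= 0) -> a = 0.
Proof.
move=> le0; apply/eqP; apply: contraT => a0.
have s0 : 0 < `|b| + 1 by apply: ltr_wpDl.
(* Chosen so that [a * t] is [t ^+ 2] times a number exceeding [- b]. *)
have := le0 (a / (`|b| + 1)).
have -> : a * (a / (`|b| + 1)) + b * (a / (`|b| + 1)) ^+ 2
    = (a / (`|b| + 1)) ^+ 2 * (`|b| + 1 + b).
  by field; rewrite gt_eqF.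
rewrite leNgt => /negP; case; apply: mulr_gt0.
  by rewrite exprn_even_gt0 //= mulf_neq0 // invr_neq0 // gt_eqF.
by have := lerNnormlW (lexx `|b|); lra.
Qed.

(** First-order condition at a maximizer: moving [x] by [t] along coordinate [i] changes
    [quad W - 2 * c * sqn] by a polynomial in [t] that is never positive, so its linear coefficient
    vanishes. *)
Lemma quad_critical W (c : R) x : (forall i j, W i j = W j i) ->
  (forall y, quad W y <= 2 * c * sqn y) -> quad W x = 2 * c * sqn x ->
  forall i, \sum_j W i j * (x 0 i - x 0 j) = c * x 0 i.
Proof.
move=> symW le_c eq_c i; set s := \sum_j _.
suff : 4 * (s - c * x 0 i) = 0 by lra.
apply: (@linear_coef_eq0 _ (quad W (delta_mx 0 i) - 2 * c)) => t.
have := le_c (x + t *: delta_mx 0 i).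
rewrite quad_perturb // sqn_perturb eq_c -/s; lra.
Qed.

Lemma rV_continuousM (f g : 'rV[R]_n -> R) :
  continuous f -> continuous g -> continuous (fun x => f x * g x).
Proof. by move=> cf cg x; exact: (continuousM (cf x) (cg x)). Qed.

Lemma quad_continuous W : continuous (quad W).
Proof.
apply: continuous_big => [|i _]; first exact: @add_continuous R^o.
apply: continuous_big => [|j _]; first exact: @add_continuous R^o.
have cB : continuous (fun x : 'rV[R]_n => x 0 i - x 0 j).
  by move=> x; apply: (@continuousB _ R^o); apply: coord_continuous.
under eq_fun do rewrite expr2.
apply: (rV_continuousM _ (rV_continuousM cB cB)); exact: cst_continuous.
Qed.

Lemma sqn_continuous : continuous sqn.
Proof.
apply: continuous_big => [|i _]; first exact: @add_continuous R^o.
under eq_fun do rewrite expr2.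
by apply: rV_continuousM; apply: coord_continuous.
Qed.

Lemma compact_sphere : compact [set x | sqn x = 1]%classic.
Proof.
apply: bounded_closed_compact.
  exists 1; split=> // M M1 x /= sx.
  rewrite [leLHS]/Num.Def.normr /= mx_normrE; apply/bigmax_leP; split.
    by apply: ltW; apply: lt_trans M1.
  move=> [i j] _ /=; rewrite ord1; apply: le_trans (ltW M1).
  rewrite -(@ler_pXn2r _ 2) ?nnegrE // expr1n real_normK ?num_real // -sx.
  rewrite /sqn (bigD1 j) //= lerDl; apply: sumr_ge0 => k _; exact: sqr_ge0.
apply: (@preimage_closed _ _ sqn [set x | x = 1]%classic).
  by move=> x _; apply: sqn_continuous.
exact: closed_eq.
Qed.

(** Extreme value theorem on the unit sphere, then homogeneity of degree two. *)
Lemma quad_max W : (0 < n)%N ->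
  exists2 x, sqn x = 1 & forall y, quad W y <= quad W x * sqn y.
Proof.
move=> n0.
have [||x] := EVT_max_rV _ compact_sphere (f := quad W).
- exists (delta_mx 0 (Ordinal n0)) => /=.
  have := sqn_perturb 0 (Ordinal n0) 1; rewrite scale1r add0r => ->.
  have -> : sqn 0 = 0 :> R by apply/eqP; rewrite sqn_eq0.
  by rewrite mxE; ring.
- by apply: continuous_subspaceT; apply: quad_continuous.
rewrite inE /= => sx maxx; exists x => // y.
have [->|y0] := eqVneq y 0.
  have -> : sqn 0 = 0 :> R by apply/eqP; rewrite sqn_eq0.
  by have := quadZ 0 W 0; rewrite scale0r expr0n mul0r mulr0 => ->.
have sy : 0 < sqn y by rewrite lt_def sqn_ge0 sqn_eq0 y0.
have := maxx ((Num.sqrt (sqn y))^-1 *: y).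
rewrite quadZ exprVn sqr_sqrtr ?sqn_ge0 // mulrC ler_pdivrMr //; apply.
by rewrite inE /= sqnZ exprVn sqr_sqrtr ?sqn_ge0 // mulVf // gt_eqF.
Qed.

End QuadraticForm.

(** * The largest distance Laplacian eigenvalue *)

Section SpectralRadius.
Variables (R : realType) (n : nat).
Implicit Types (G H : sgraph 'I_n) (x y : 'rV[R]_n).

Definition wdist G i j : R := (dist G i j)%:R.

Lemma wdist_sym G : connected_graph G -> forall i j, wdist G i j = wdist G j i.
Proof. by move=> connG i j; rewrite /wdist dist_sym. Qed.

Lemma mul_distL G x j : connected_graph G ->
  (x *m distL_mx R G) 0 j = \sum_i wdist G j i * (x 0 j - x 0 i).
Proof.
move=> connG; rewrite mxE.
under eq_bigr => i _ do rewrite !mxE mulrBr.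
rewrite sumrB (bigD1 j) //= eqxx mulr1n big1 ?addr0; last first.
  by move=> i ij; rewrite (negbTE ij) mulr0n mulr0.
rewrite /transmission natr_sum mulr_sumr -sumrB; apply: eq_bigr => i _.
by rewrite /wdist (dist_sym connG i j); ring.
Qed.

(** Half the maximum of the form on the unit sphere is an eigenvalue, since the maximizer is
    critical; hence it is at most [rhoL]. *)
Lemma rayleigh G x : (0 < n)%N -> connected_graph G ->
  quad (wdist G) x <= 2 * rhoL R G * sqn x.
Proof.
move=> n0 connG; have [z z1 maxz] := quad_max (wdist G) n0.
have z0 : z != 0 by rewrite -sqn_eq0 z1 oner_eq0.
have eq_z := @quad_critical _ _ (wdist G) (quad (wdist G) z / 2) z (wdist_sym connG).
suff le_rho : quad (wdist G) z <= 2 * rhoL R G.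
  by apply: le_trans (maxz x) _; rewrite ler_wpM2r ?sqn_ge0.
suff : quad (wdist G) z / 2 <= rhoL R G by lra.
apply: (rhoL_largest R G n0).2; apply/eigenvalueP; exists z => //.
apply/rowP => j; rewrite mul_distL // mxE; apply: eq_z => [y|]; last first.
  by rewrite z1; field.
by apply: le_trans (maxz y) _; rewrite mulrCA mulfV ?mulr1 // pnatr_eq0.
Qed.

Lemma rhoL_vector G : (0 < n)%N -> connected_graph G ->
  exists2 x : 'rV[R]_n, x != 0 &
    forall i, \sum_j wdist G i j * (x 0 i - x 0 j) = rhoL R G * x 0 i.
Proof.
move=> n0 connG; have /eigenvalueP[x xE x0] := (rhoL_largest R G n0).1.
by exists x => // i; rewrite -mul_distL // xE mxE.
Qed.

Lemma quad_rhoL G x : connected_graph G ->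
    (forall i, \sum_j wdist G i j * (x 0 i - x 0 j) = rhoL R G * x 0 i) ->
  quad (wdist G) x = 2 * rhoL R G * sqn x.
Proof.
move=> connG xE; rewrite quadE; last exact: wdist_sym.
rewrite -mulrA; congr (_ * _); rewrite /sqn mulr_sumr.
by apply: eq_bigr => i _; rewrite xE; ring.
Qed.

(** An eigenvector of [G] for [rhoL R G] serves as test vector for [H]. *)
Lemma rhoL_le G H : (0 < n)%N -> connected_graph G -> connected_graph H ->
  (forall i j, (dist G i j <= dist H i j)%N) -> rhoL R G <= rhoL R H.
Proof.
move=> n0 connG connH leGH; have [x x0 xE] := rhoL_vector n0 connG.
have sx : 0 < sqn x by rewrite lt_def sqn_ge0 sqn_eq0 x0.
suff : 2 * rhoL R G * sqn x <= 2 * rhoL R H * sqn x.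
  by rewrite (ler_pM2r sx) (ler_pM2l (ltr0Sn R 1)).
have le_quad : quad (wdist G) x <= quad (wdist H) x.
  by apply: ler_quad => i j; rewrite ler_nat.
by have := le_trans le_quad (rayleigh x n0 connH); rewrite (quad_rhoL connG xE).
Qed.

Lemma rhoL_gt0 G : (1 < n)%N -> connected_graph G -> 0 < rhoL R G.
Proof.
move=> n1 connG; have n0 : (0 < n)%N by lia.
pose i0 := Ordinal n0; pose i1 := Ordinal n1.
pose e : 'rV[R]_n := delta_mx 0 i0.
have sqe : sqn e = 1.
  rewrite /sqn (bigD1 i0) //= mxE !eqxx expr1n big1 ?addr0 // => i ii0.
  by rewrite mxE (negbTE ii0) andbF expr0n.
suff : 0 < quad (wdist G) e by have := rayleigh e n0 connG; rewrite sqe; lra.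
have ge0 i j : 0 <= wdist G i j * (e 0 i - e 0 j) ^+ 2.
  by rewrite mulr_ge0 ?sqr_ge0 // ler0n.
rewrite /quad (bigD1 i0) //= ltr_pwDl //; last first.
  by apply: sumr_ge0 => i _; apply: sumr_ge0.
rewrite (bigD1 i1) //= ltr_pwDl //; last exact: sumr_ge0.
rewrite !mxE !eqxx /= subr0 expr1n mulr1 ltr0n lt0n dist_eq0 //.
Qed.

(** Here [p] and [q] will be the forms after the two moves, [t] that of [G], [s] the convexity
    excess and [r] the common upper bound. *)
Lemma half_sum_squeeze (p q r s t : R) : p + q = 2 * t + s -> 0 <= s ->
  p <= r -> q <= r -> t = r -> p = r /\ s = 0.
Proof. by move=> *; split; lra. Qed.

(* If neither move increased the largest eigenvalue, then, by convexity of the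
   distance, an eigenvector [x] of [G] would also be critical for both moves and
   constant on the moved branch. The difference of the eigenvalue equations at a
   vertex [c] outside the branch then forces [x c] to have the same value. *)
Lemma rhoL_move G w b a1 a2 : connected_graph G -> acyclic G ->
    adj G w b -> adj G w a1 -> adj G w a2 -> a1 != b -> a2 != b -> a1 != a2 ->
  rhoL R (swap G b w a1) <= rhoL R G -> rhoL R (swap G b w a2) <= rhoL R G ->
  False.
Proof.
move=> connG acycG wb wa1 wa2 a1b a2b a12 le1 le2.
have n1 : (1 < n)%N.
  by rewrite -[n]card_ord; apply/card_gt1P; exists w, b; rewrite ?(adj_neq wb).
have n0 : (0 < n)%N by lia.
set B := branch G w b; set rho := rhoL R G in le1 le2.
have bB : b \in B := branch_refl _ _ _.
have wB : w \notin B := branchN wb.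
pose g a i j : R := (hung_dist G B b a i j)%:R.
have connS a : adj G w a -> a != b -> connected_graph (swap G b w a).
  move=> wa ab; apply: swap_connected => //; first by rewrite eq_sym.
  by apply: connect1; rewrite /= ab (adj_neq wb) adj_sym wa.
have g_le a y : adj G w a -> a != b -> rhoL R (swap G b w a) <= rho ->
    quad (g a) y <= 2 * rho * sqn y.
  move=> wa ab le_rho; apply: (@le_trans _ _ (quad (wdist (swap G b w a)) y)).
    by apply: ler_quad => i j; rewrite ler_nat move_dist.
  apply: le_trans (rayleigh y n0 (connS a wa ab)) _.
  apply: (ler_wpM2r (sqn_ge0 y)); apply: (ler_wpM2l (ler0n R 2)).
  exact: le_rho.
have [x x0 xE] := rhoL_vector n0 connG.
have conv i j : (2 * dist G i j <=
    hung_dist G B b a1 i j + hung_dist G B b a2 i j)%N.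
  rewrite -(branch_dist connG acycG i j wb) -/B /hung_dist.
  have ci := dist_convex connG acycG i wa1 wa2 a12.
  have cj := dist_convex connG acycG j wa1 wa2 a12.
  have e c := dist_sym connG i c.
  move: ci cj (e w) (e a1) (e a2); clear.
  by case: ifP => _; [|case: ifP => _]; lia.
have excess_ge0 i j :
    0 <= (g a1 i j + g a2 i j - 2 * wdist G i j) * (x 0 i - x 0 j) ^+ 2.
  rewrite mulr_ge0 ?sqr_ge0 // subr_ge0 /g /wdist -natrD -natrM ler_nat.
  exact: conv.
have excess : quad (g a1) x + quad (g a2) x = 2 * quad (wdist G) x
    + \sum_i \sum_j (g a1 i j + g a2 i j - 2 * wdist G i j) * (x 0 i - x 0 j) ^+ 2.
  rewrite /quad mulr_sumr -!big_split; apply: eq_bigr => i _.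
  rewrite mulr_sumr -!big_split; apply: eq_bigr => j _ /=; ring.
have sum_ge0 : 0 <= \sum_i \sum_j
    (g a1 i j + g a2 i j - 2 * wdist G i j) * (x 0 i - x 0 j) ^+ 2.
  by apply: sumr_ge0 => i _; apply: sumr_ge0.
have l1 := g_le a1 x wa1 a1b le1; have l2 := g_le a2 x wa2 a2b le2.
have xq := quad_rhoL connG xE; rewrite -/rho in xq.
have [xq1 /eqP] := half_sum_squeeze excess sum_ge0 l1 l2 xq.
rewrite psumr_eq0 => [/allP excess0|i _]; last exact: sumr_ge0.
(* Either move takes [w] one step farther from each [v] in [B], so the pair [w], [v] has excess 2
   and its vanishing term forces equality. *)
have xB v : v \in B -> x 0 v = x 0 w.
  move=> vB; apply/eqP; rewrite eq_sym -subr_eq0 -sqrf_eq0.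
  have := excess0 w; rewrite mem_index_enum => /(_ isT).
  rewrite psumr_eq0 => [/allP /(_ v)|j _]; last exact: excess_ge0.
  rewrite mem_index_enum => /(_ isT); rewrite mulf_eq0 => /orP[|//].
  rewrite /wdist -(branch_dist connG acycG w v wb) -/B /g /hung_dist.
  rewrite vB (negbTE wB) /= dist_xx (dist_adj connG wa1) (dist_adj connG wa2).
  by rewrite subr_eq0 -natrD -natrM eqr_nat => /eqP; clear; lia.
have g_sym i j : g a1 i j = g a1 j i by rewrite /g hung_dist_sym.
have xE1 := quad_critical g_sym (fun y => g_le a1 y wa1 a1b le1) xq1.
have xC u : x 0 u = x 0 w.
  have [vB|vB] := boolP (u \in B); first exact: xB.
  have : \sum_j (g a1 u j - wdist G u j) * (x 0 u - x 0 j) = 0.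
    under eq_bigr => j _ do rewrite mulrBl.
    by rewrite sumrB xE1 xE -/rho subrr.
  rewrite (bigID (mem B)) /= [X in _ + X]big1 ?addr0 => [|j jB]; last first.
    by rewrite /g /hung_dist (negbTE vB) (negbTE jB) eqxx subrr mul0r.
  (* All vertices of the branch contribute the same term, whose distance factor is nonzero by
     [dist_nbr_neq]. *)
  rewrite (eq_bigr (fun=> ((dist G a1 u)%:R - (dist G w u)%:R) * (x 0 u - x 0 w))).
    rewrite sumr_const -[_ *+ #|_|]mulr_natl => /eqP; rewrite !mulf_eq0 pnatr_eq0 !subr_eq0.
    rewrite eqr_nat [dist _ _ _ == _]eq_sym (negbTE (dist_nbr_neq _ _ _ wa1)) //=.
    by case/orP=> [/eqP/card0_eq/(_ b)|/eqP //]; rewrite bB.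
  move=> j jB; rewrite (xB j jB) /g /wdist.
  rewrite -(branch_dist connG acycG u j wb) -/B /hung_dist (negbTE vB) jB /=.
  rewrite (dist_sym connG u a1) (dist_sym connG u w) !natrD; ring.
(* A constant vector has eigenvalue 0, but [rho] is positive, so [x] would be zero. *)
have rho0 : rho * x 0 w = 0.
  by rewrite -xE big1 // => j _; rewrite xC subrr mulr0.
have /negP := x0; apply; apply/eqP/rowP => i; rewrite xC mxE.
by move/eqP: rho0; rewrite mulf_eq0 gt_eqF ?rhoL_gt0 // => /eqP.
Qed.

End SpectralRadius.

(** * Graphs of maximal spectral radius *)

Section Extremal.
Variables (R : realType) (n k : nat).
Hypotheses (n_gt1 : (1 < n)%N) (k_gt1 : (1 < k)%N).
Implicit Types (G H : sgraph 'I_n).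

Let V_gt1 : (1 < #|{: 'I_n}|)%N. Proof. by rewrite card_ord. Qed.

Definition maximal_rhoL (P : sgraph 'I_n -> Prop) G :=
  P G /\ forall H, P H -> rhoL R H <= rhoL R G.

Lemma exists_maximal (P : sgraph 'I_n -> Prop) G :
  P G -> exists M, maximal_rhoL P M.
Proof.
(* Graphs are encoded by Boolean functions on pairs, symmetrized and cleared on the diagonal, so
   that the maximum is over a finite type. *)
pose e (f : {ffun 'I_n * 'I_n -> bool}) u v := (u != v) && (f (u, v) || f (v, u)).
have e_sym f : symmetric (e f) by move=> u v; rewrite /e eq_sym orbC.
have e_irr f : irreflexive (e f) by move=> u; rewrite /e eqxx.
pose graph f := SGraph (e_sym f) (e_irr f).
have graphK H : graph [ffun p => adj H p.1 p.2] = H.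
  apply: sgraph_ext => u v; rewrite /= /e !ffunE /= (adj_sym H v) orbb.
  by apply: andb_idl; apply: adj_neq.
move=> PG; pose f0 := [ffun p => adj G p.1 p.2].
have Pf0 : `[< P (graph f0) >] by apply/asboolP; rewrite graphK.
case: (@arg_maxP _ R _ f0 (fun f => `[< P (graph f) >]) (fun f => rhoL R (graph f)) Pf0).
move=> f /asboolP Pf maxf; exists (graph f); split=> [|H PH]; first exact: Pf.
by rewrite -(graphK H); apply: maxf; rewrite graphK; apply/asboolP.
Qed.

(** Asking for at least [k] makes the class stable under edge deletions that keep the graph
    connected. *)
Definition many_pendants G := connected_graph G /\ (k <= #|pendants G|)%N.

Lemma rhoL_sub H G : subgraph H G -> connected_graph H -> rhoL R G <= rhoL R H.
Proof.
move=> HG connH; apply: rhoL_le => //; first exact: ltnW.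
  exact: sub_connected connH.
by move=> i j; apply: dist_sub.
Qed.

Lemma maximal_sub H G : subgraph H G -> connected_graph H ->
  maximal_rhoL many_pendants G -> maximal_rhoL many_pendants H.
Proof.
move=> HG connH [[connG kG] maxG]; split.
  by split=> //; apply: leq_trans kG (subset_leq_card _); apply: pendants_sub.
by move=> G' /maxG /le_trans; apply; apply: rhoL_sub.
Qed.

Lemma maximal_spanning_tree G : maximal_rhoL many_pendants G ->
  exists H, [/\ acyclic H, subgraph H G & maximal_rhoL many_pendants H].
Proof.
move=> maxG; have [H [connH acycH HG]] := exists_acyclic maxG.1.1.
exists H; split; [exact: acycH|exact: HG|exact: maximal_sub HG connH maxG].
Qed.

(** Both moves stay in the class, the cardinality bounds allowing for the pendant vertex that a move
    may cost; so neither increases [rhoL], against [rhoL_move]. *)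
Lemma maximal_move G w b a1 a2 : acyclic G -> maximal_rhoL many_pendants G ->
    adj G w b -> adj G w a1 -> adj G w a2 -> a1 != b -> a2 != b -> a1 != a2 ->
    (k <= #|pendants G :\ a1|)%N -> (k <= #|pendants G :\ a2|)%N ->
  False.
Proof.
move=> acycG [[connG _] maxG] wb wa1 wa2 a1b a2b a12 k1 k2.
have many a : adj G w a -> a != b -> (k <= #|pendants G :\ a|)%N ->
    many_pendants (swap G b w a).
  move=> wa ab ka; split; last first.
    by apply: leq_trans ka (subset_leq_card _); apply: pendants_move.
  apply: swap_connected; rewrite // 1?eq_sym //.
  by apply: connect1; rewrite /= ab (adj_neq wb) adj_sym wa.
apply: (rhoL_move (R := R) connG acycG wb wa1 wa2 a1b a2b a12).
  exact: maxG (many _ wa1 a1b k1).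
exact: maxG (many _ wa2 a2b k2).
Qed.

(** With more than [k], hence at least three, pendant vertices there is a branching vertex, and one
    pendant vertex can be spared for a move. *)
Lemma maximal_card_pendants G : acyclic G -> maximal_rhoL many_pendants G ->
  #|pendants G| = k.
Proof.
move=> acycG maxG; have [[connG kG] _] := maxG; apply/eqP; rewrite eqn_leq kG.
rewrite andbT leqNgt; apply/negP => ltk.
have [|w [b [a1 [a2 [[wb wa1 wa2] ba1 ba2 a12]]]]] := exists_branching connG.
  exact: leq_trans ltk.
have card_rem a : (k <= #|pendants G :\ a|)%N.
  by move: ltk; rewrite (cardsD1 a); case: (a \in _) => //= /ltnW.
by apply: (maximal_move acycG maxG wb wa1 wa2); rewrite // eq_sym.
Qed.

(** Moving the branch of a third neighbour to [a1] or [a2] would cost no pendant vertex. *)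
Lemma maximal_nbr G w a1 a2 b : acyclic G -> maximal_rhoL many_pendants G ->
    adj G w a1 -> adj G w a2 -> a1 != a2 ->
    a1 \notin pendants G -> a2 \notin pendants G ->
  adj G w b -> b = a1 \/ b = a2.
Proof.
move=> acycG maxG wa1 wa2 a12 a1N a2N wb.
have [->|ba1] := eqVneq b a1; first by left.
have [->|ba2] := eqVneq b a2; first by right.
have card_rem a : a \notin pendants G -> (k <= #|pendants G :\ a|)%N.
  by move=> aN; have := maxG.1.2; rewrite (cardsD1 a) (negbTE aN).
by exfalso; apply: (maximal_move acycG maxG wb wa1 wa2); rewrite ?card_rem // eq_sym.
Qed.

(* An edge [u v] of [G] outside its spanning tree [H] could be exchanged for the
   first edge [u z] of the path from [u] to [v] in [H]; as [z] has degree 2 in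
   [H], this would create an additional pendant vertex. *)
Lemma maximal_acyclic G : #|pendants G| = k -> maximal_rhoL many_pendants G ->
  acyclic G.
Proof.
move=> kG maxG; have connG := maxG.1.1.
have [H [acycH HG maxH]] := maximal_spanning_tree maxG.
have connH := maxH.1.1.
have eq_pend : pendants H = pendants G.
  apply/esym/eqP; rewrite eqEcard pendants_sub //=.
  by rewrite kG (maximal_card_pendants acycH maxH).
suff GH : subgraph G H by rewrite (@sgraph_ext _ G H) // => u v; apply/idP/idP => [/GH|/HG].
move=> u v uv; apply: contraT => uvN.
(* A pendant vertex of [H] is pendant in [G] with the same neighbour, so all its edges of [G] lie in
   [H]. *)
have endN x y : adj G x y -> ~~ adj H x y -> x \notin pendants H.
  move=> xy; apply: contraNN => xP; have [z xz] := connected_nbr x connH V_gt1.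
  by rewrite eq_pend in xP; rewrite (pendant_uniq xP xy (HG _ _ xz)).
have uN := endN _ _ uv uvN.
have vN : v \notin pendants H by apply: (endN v u); rewrite adj_sym.
have /connectP[p0 /shortenP[p pathp uniqp _] lastp] := connH u v.
have lN : last u p \notin pendants H by rewrite -lastp.
have innerN := path_nonpendant pathp uniqp uN lN.
case: p lastp pathp uniqp {lN} innerN => [vu|z p lastp pathp uniqp innerN].
  by rewrite vu adj_irr in uv.
have uz : adj H u z by case/andP: pathp.
have zl : z != last u (z :: p) by rewrite -lastp; apply: contraNneq uvN => <-.
have [x [y [xy zx zy xp yp]]] := path_interior pathp uniqp (mem_head z p) zl.
(* Both path neighbours of [z] are non-pendant, so maximality of [H] makes them its only ones; one
   of them is [u]. *)
have zdeg t : adj H z t -> t = x \/ t = y.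
  by apply: (maximal_nbr acycH maxH zx zy xy); apply: innerN.
have offzv : connect (off H u) z v.
  apply/connectP; exists p => //; move: uniqp pathp => /= /and3P[up _ _] /andP[_].
  have : z != u by move: up; rewrite inE negb_or eq_sym => /andP[].
  move: up; rewrite inE negb_or => /andP[_].
  elim: p z {lastp innerN uz zl zx zy xp yp zdeg} => //= t p IHp z.
  rewrite inE negb_or => /andP[ut up] zu /andP[zt pathp].
  by rewrite zt zu eq_sym ut IHp // eq_sym.
pose H' := swap H u z v.
have H'G : subgraph H' G.
  move=> s t /andP[_ /orP[/andP[/HG]//|]] /orP[]/andP[/eqP-> /eqP->] //.
  by rewrite adj_sym.
have connH' : connected_graph H'.
  by apply: swap_connected; rewrite ?(adj_neq uv) // off_connect_sym.
have zP : z \in pendants H'.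
  apply/pendantP => // s t.
  have nbr q : adj H' z q -> adj H z q /\ q != u.
    have /negbTE zv : z != v by rewrite lastp.
    rewrite /= /swap_adj /same_edge eqxx [z == u]eq_sym (negbTE (adj_neq uz)) zv.
    by rewrite /= orbF => /and3P[].
  rewrite adj_sym in uz.
  have := zdeg _ uz => - [] ux /nbr[/zdeg zs su] /nbr[/zdeg zt tu];
    rewrite ux in su tu; move: zs zt su tu => [] -> [] ->; by rewrite ?eqxx.
(* A spanning tree of [H'] is a maximizer too, so it has exactly [k] pendant vertices, yet it has
   those of [G] and also [z]. *)
have [H'' [acycH'' H''H' maxH'']] := maximal_spanning_tree (maximal_sub H'G connH' maxG).
have := maximal_card_pendants acycH'' maxH''.
suff : (k < #|pendants H''|)%N by move=> /[swap] ->; rewrite ltnn.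
rewrite -kG; apply: proper_card; apply/properP; split.
  apply: (@fintype.subset_trans _ _ (pendants H')); apply: pendants_sub => //.
  exact: maxH''.1.1.
exists z; first by apply: (fintype.subsetP (pendants_sub H''H' maxH''.1.1 V_gt1)).
by rewrite -eq_pend; apply: innerN; rewrite !inE eqxx orbT.
Qed.

End Extremal.

Theorem theorem2p6 (R : realType) (n k : nat) (hk : (2 <= k <= n - 2)%N)
    (G : sgraph 'I_n) (hG : Re_class k G)
    (hmax : forall G' : sgraph 'I_n, Re_class k G' -> rhoL R G' <= rhoL R G) :
  D_class k G.
Proof.
have [connG sizeP] := hG; have k_gt1 : (1 < k)%N by case/andP: hk.
have n_gt1 : (1 < n)%N by lia.
have manyG : many_pendants k G by split; rewrite ?sizeP.
(* A spanning tree of a maximizer in the larger class has exactly [k] pendant vertices, so [G] does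
   at least as well and is maximal there too. *)
have [M maxM] := exists_maximal R manyG.
have [H [acycH _ maxH]] := maximal_spanning_tree n_gt1 maxM.
have le_HG : rhoL R H <= rhoL R G.
  by apply: hmax; split; [exact: maxH.1.1|exact: (maximal_card_pendants n_gt1 k_gt1 acycH maxH)].
have maxG : maximal_rhoL R (many_pendants k) G.
  split=> [|G' /maxH.2 le_G'H]; first exact: manyG.
  exact: le_trans le_G'H le_HG.
have acycG := maximal_acyclic n_gt1 k_gt1 sizeP maxG.
have sizeN : #|~: pendants G| = (n - k)%N by rewrite cardsCs finset.setCK card_ord sizeP.
apply: caterpillar_iso => //; first by rewrite sizeN; lia.
by move=> w a1 a2 b wa1 wa2 a12 a1N a2N; apply: (maximal_nbr n_gt1 acycG maxG).
Qed.
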